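(* A delta-matroid on a finite set $V$ is representable over a field $\mathbb{F}$ if and only if it admits a special chain-group representation $(N,a,b)$ for a Lagrangian chain-group $N$ on $V$ to $K=\mathbb{F}^2$ and special supplementary chains $a,b$ on $V$ to $K$, where $\langle\,,\,\rangle_K$ is either skew-symmetric or symmetric.
   Context: $K=\mathbb{F}^2$ carries a bilinear form $\langle\,,\,\rangle_K$ equal to $b^+(\binom ab,\binom cd)=ad+bc$ or $b^-(\binom ab,\binom cd)=ad-bc$. Chains on $V$ to $K$ are maps $V\to K$, forming $K^V$ with $\langle f,g\rangle=\sum_{x\in V}\langle f(x),g(x)\rangle_K$; a chain-group is a subspace of $K^V$, isotropic if $\langle f,g\rangle=0$ for all $f,g$ in it, Lagrangian if isotropic of dimension $|V|$. Chains $a,b$ on $V$ to $K$ are supplementary if for all $x\in V$: $\langle a(x),a(x)\rangle_K=\langle b(x),b(x)\rangle_K=0$ and $\langle a(x),b(x)\rangle_K=1$. For an isotropic chain-group $N$ and supplementary $a,b$, let $\mathcal F$ be the set of $X\subseteq V$ such that there is no nonzero $f\in N$ with $\langle f(x),a(x)\rangle_K=0$ for all $x\in V\setminus X$ and $\langle f(x),b(x)\rangle_K=0$ for all $x\in X$; then $(V,\mathcal F)$ is a delta-matroid (Bouchet), and $(N,a,b)$ is called a chain-group representation of it; it is special if $a(v),b(v)\in\{\pm\binom10,\pm\binom01\}$ for all $v$. A delta-matroid $(V,\mathcal F)$: $\mathcal F$ nonempty family of subsets with the symmetric exchange axiom (if $F,F'\in\mathcal F$, $x\in F\Delta F'$,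 there is $y\in F\Delta F'$ with $F\Delta\{x,y\}\in\mathcal F$). It is representable over $\mathbb{F}$ if it equals $(V,\{F\Delta Y: F\in\mathcal F(A)\})$ for some $Y\subseteq V$ and some skew-symmetric (i.e. $A=-A^t$ with zero diagonal) or symmetric $V\times V$ matrix $A$ over $\mathbb{F}$, where $\mathcal F(A)=\{X\subseteq V: A[X]\text{ nonsingular}\}$. *)

(* Defs.v *)
From HB Require Import structures.
From mathcomp Require Import all_boot all_order all_algebra.
Set Implicit Arguments.
Unset Strict Implicit.
Unset Printing Implicit Defensive.
Import GRing.Theory.
Local Open Scope ring_scope.

Definition symdiff (V : finType) (A B : {set V}) : {set V} :=
  (A :\: B) :|: (B :\: A).

Record delta_matroid (V : finType) := DeltaMatroid {
  feasible : {set {set V}};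
  feasible_neq0 : feasible != set0;
  (* y = x is allowed, in which case [set x; y] is a singleton *)
  symmetric_exchange : forall F F' : {set V},
    F \in feasible -> F' \in feasible ->
    forall x : V, x \in symdiff F F' ->
    exists2 y : V, y \in symdiff F F' & symdiff F [set x; y] \in feasible
}.

Section Matrices.
Variables (F : fieldType) (V : finType).

(* A V x V matrix is a function V -> V -> F, as MathComp matrices are indexed
   by ordinals only; the order in which enum_val lists X does not affect the
   determinant of the principal submatrix A[X]. The 0 x 0 matrix A[set0] has
   determinant 1, hence is nonsingular. *)
Definition principal_submx (A : V -> V -> F) (X : {set V}) : 'M[F]_#|X| :=
  \matrix_(i, j) A (enum_val i) (enum_val j).

Definition nonsingular_sets (A : V -> V -> F) : {set {set V}} :=
  [set X : {set V} | principal_submx A X \in unitmx].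

Definition skew_symmetric (A : V -> V -> F) : Prop :=
  (forall x y, A x y = - A y x) /\ (forall x, A x x = 0).

Definition symmetric_matrix (A : V -> V -> F) : Prop :=
  forall x y, A x y = A y x.

End Matrices.

Definition representable (F : fieldType) (V : finType)
    (M : delta_matroid V) : Prop :=
  exists (Y : {set V}) (A : V -> V -> F),
    (skew_symmetric A \/ symmetric_matrix A) /\
    feasible M = [set symdiff X Y | X in nonsingular_sets A].

Section Chains.
Variable F : fieldType.

Definition pairK (a b : F) : 'cV[F]_2 :=
  \col_(i < 2) if i == 0 then a else b.

Definition bplus (u v : 'cV[F]_2) : F := u 0 0 * v 1 0 + u 1 0 * v 0 0.

Definition bminus (u v : 'cV[F]_2) : F := u 0 0 * v 1 0 - u 1 0 * v 0 0.

Variable V : finType.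

Variable formK : 'cV[F]_2 -> 'cV[F]_2 -> F.

Definition chain_form (f g : {ffun V -> 'cV[F]_2}) : F :=
  \sum_(x : V) formK (f x) (g x).

Definition isotropic (N : {vspace {ffun V -> 'cV[F]_2}}) : Prop :=
  forall f g, f \in N -> g \in N -> chain_form f g = 0.

Definition lagrangian (N : {vspace {ffun V -> 'cV[F]_2}}) : Prop :=
  isotropic N /\ \dim N = #|V|.

Definition supplementary (a b : {ffun V -> 'cV[F]_2}) : Prop :=
  forall x, [/\ formK (a x) (a x) = 0,
                formK (b x) (b x) = 0 &
                formK (a x) (b x) = 1].

Definition chain_group_feasible (N : {vspace {ffun V -> 'cV[F]_2}})
    (a b : {ffun V -> 'cV[F]_2}) (X : {set V}) : Prop :=
  ~ exists f : {ffun V -> 'cV[F]_2},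
      [/\ f \in N, f != 0,
          (forall x, x \notin X -> formK (f x) (a x) = 0) &
          (forall x, x \in X -> formK (f x) (b x) = 0)].

Definition chain_group_representation (M : delta_matroid V)
    (N : {vspace {ffun V -> 'cV[F]_2}}) (a b : {ffun V -> 'cV[F]_2}) : Prop :=
  [/\ isotropic N, supplementary a b &
      forall X : {set V}, X \in feasible M <-> chain_group_feasible N a b X].

Definition special_chain (a : {ffun V -> 'cV[F]_2}) : Prop :=
  forall v, a v \in [:: pairK 1 0; - pairK 1 0; pairK 0 1; - pairK 0 1].

Definition special_representation (M : delta_matroid V)
    (N : {vspace {ffun V -> 'cV[F]_2}}) (a b : {ffun V -> 'cV[F]_2}) : Prop :=
  [/\ chain_group_representation M N a b, special_chain a & special_chain b].

End Chains.

(* Main.v *)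
(** Write a chain [f] in the coordinates [p x = <f x, a x>] and
    [q x = <f x, b x>].  Then [<f, g>] is the sum over [x] of
    [p f x * q g x + eps * q f x * p g x], where [eps = 1] for [bplus] and
    [eps = -1] for [bminus].  For a Lagrangian [N], feasibility of the empty
    set says that [p] is injective on [N], hence bijective onto [F^V]; so [N]
    is the graph [q = A p] of a matrix [A], and isotropy of [N] means
    [A = - eps A^T].  A nonzero chain obstructing [X] is then a nonzero vector
    supported on [X] and killed by [A[X]].  Swapping [a] and [b] on [Y]
    translates the feasible sets by [Y], which reduces everything to the case
    where the empty set is feasible. *)

Require Import Defs.
From HB Require Import structures.
From mathcomp Require Import all_boot all_order all_algebra.
From mathcomp Require Import ring.
Set Implicit Arguments.
Unset Strict Implicit.
Unset Printing Implicit Defensive.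
Import GRing.Theory.
Local Open Scope ring_scope.

(** * Symmetric differences and nonsingular principal submatrices *)

Section SymmetricDifference.
Variable V : finType.
Implicit Types A B : {set V}.

Lemma in_symdiff A B x : (x \in symdiff A B) = (x \in A) (+) (x \in B).
Proof. by rewrite !inE; case: (x \in A); case: (x \in B). Qed.

Lemma symdiffK B : cancel (fun A => symdiff A B) (fun A => symdiff A B).
Proof. by move=> A; apply/setP=> x; rewrite !in_symdiff addbK. Qed.

Lemma symdiffv A : symdiff A A = set0.
Proof. by apply/setP=> x; rewrite in_symdiff addbb inE. Qed.

Lemma in_imset_symdiff (S : {set {set V}}) A B :
  (A \in [set symdiff X B | X in S]) = (symdiff A B \in S).
Proof.
apply/imsetP/idP=> [[X XS ->] | AS]; first by rewrite symdiffK.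
by exists (symdiff A B); rewrite ?symdiffK.
Qed.

End SymmetricDifference.

(** Extension by zero identifies the kernel of [A[X]] with the functions supported on [X] that [A]
    kills on the rows in [X]. This removes the indexing by ordinals. *)
Lemma nonsingular_setsP (F : fieldType) (V : finType) (A : V -> V -> F)
    (X : {set V}) :
  X \in nonsingular_sets A <->
  forall u : V -> F, (forall x, x \notin X -> u x = 0) ->
    (forall x, x \in X -> \sum_y A x y * u y = 0) -> forall x, u x = 0.
Proof.
have sumX x (u : V -> F) : (forall y, y \notin X -> u y = 0) ->
  \sum_y A x y * u y = \sum_(i < #|X|) A x (enum_val i) * u (enum_val i).
  move=> uX; rewrite -(big_enum_val (fun y => A x y * u y)) /=.
  rewrite [RHS]big_mkcond; apply: eq_bigr => y _.
  by case: ifPn => // /uX->; rewrite mulr0.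
rewrite inE -unitmx_tr -row_free_unit; split=> [freeA u uX Au0 x | injA].
  case: (boolP (x \in X)) => [xX | /uX //].
  have: (\row_i u (enum_val i)) *m (principal_submx A X)^T = 0.
    apply/rowP=> i; rewrite !mxE -[RHS](Au0 _ (enum_valP i)) sumX //.
    by apply: eq_bigr => j _; rewrite !mxE mulrC.
  rewrite -[RHS](mul0mx _ (principal_submx A X)^T) => /(row_free_inj freeA).
  move/rowP/(_ (enum_rank_in xX x)).
  by rewrite !mxE enum_rankK_in.
apply: inj_row_free => v vA0.
(* The extension of [v] by zero: the sum is empty off [X], and has a single term on [X] by
   injectivity of [enum_val]. *)
pose u x := \sum_(i < #|X| | enum_val i == x) v 0 i.
have uE i : u (enum_val i) = v 0 i.
  by apply: big_pred1 => j; rewrite (inj_eq enum_val_inj).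
have uX x : x \notin X -> u x = 0.
  by move=> xX; apply: big1 => i /eqP ix; rewrite -ix enum_valP in xX.
apply/rowP=> i; rewrite -uE mxE; apply: injA => // x xX.
move/rowP/(_ (enum_rank_in xX x)): vA0; rewrite !mxE => vA0.
rewrite sumX // -[RHS]vA0; apply: eq_bigr => j _.
by rewrite !mxE enum_rankK_in // uE mulrC.
Qed.

(** * Coordinates for a form of sign [eps] *)

Section EpsilonForm.
Variables (F : fieldType) (V : finType).
Variables (formK : 'cV[F]_2 -> 'cV[F]_2 -> F) (eps : F).
Hypothesis eps2 : eps * eps = 1.
Hypothesis formE :
  forall u v, formK u v = u 0 0 * v 1 0 + eps * (u 1 0 * v 0 0).

Implicit Types (f g a b : {ffun V -> 'cV[F]_2}).
Implicit Types (N : {vspace {ffun V -> 'cV[F]_2}}) (X Y : {set V}).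
Implicit Types (A : V -> V -> F).

Let eps_neq0 : eps != 0.
Proof. by apply/eqP=> e0; move/eqP: eps2; rewrite e0 mul0r eq_sym oner_eq0. Qed.

Let formC u v : formK u v = eps * formK v u.
Proof. by rewrite !formE mulrDr !mulrA eps2 mul1r addrC; congr (_ + _); ring. Qed.

Let formDl u v w : formK (u + v) w = formK u w + formK v w.
Proof. by rewrite !formE !mxE; ring. Qed.

Let formZl c u w : formK (c *: u) w = c * formK u w.
Proof. by rewrite !formE !mxE; ring. Qed.

Let formZr c u w : formK u (c *: w) = c * formK u w.
Proof. by rewrite !formE !mxE; ring. Qed.

Let form0l w : formK 0 w = 0.
Proof. by rewrite !formE !mxE; ring. Qed.

Let form_suml (I : finType) (h : I -> 'cV[F]_2) w :
  formK (\sum_i h i) w = \sum_i formK (h i) w.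
Proof.
by apply: (big_morph (formK^~ w)) => [u v|]; rewrite ?formDl ?form0l.
Qed.

(* [<a, a> = 0] only says [(1 + eps) a0 a1 = 0]; multiplying by [<a, b> = 1]
   avoids a case distinction on the characteristic. *)
Lemma form_coord a b x u v : supplementary formK a b ->
  formK u v =
    formK u (a x) * formK v (b x) + eps * (formK u (b x) * formK v (a x)).
Proof.
move=> /(_ x)[]; move: (a x) (b x) => c d; rewrite !formE.
move: (u 0 0) (u 1 0) (v 0 0) (v 1 0) (c 0 0) (c 1 0) (d 0 0) (d 1 0).
move=> u0 u1 v0 v1 c0 c1 d0 d1 cc dd cd.
have c1d1 : (1 + eps) * (c1 * d1) = 0.
  rewrite -[LHS]mulr1 -{2}cd.
  transitivity (d1 * d1 * (c0 * c1 + eps * (c1 * c0))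
    + eps * (c1 * c1 * (d0 * d1 + eps * (d1 * d0)))); first by ring.
  by rewrite cc dd !mulr0 addr0.
have c0d0 : (1 + eps) * (c0 * d0) = 0.
  rewrite -[LHS]mulr1 -{2}cd.
  transitivity (c0 * c0 * (d0 * d1 + eps * (d1 * d0))
    + eps * (d0 * d0 * (c0 * c1 + eps * (c1 * c0)))); first by ring.
  by rewrite cc dd !mulr0 addr0.
(* The right-hand side grouped by the products of [u0], [u1] with [v0], [v1]. The final multiple of
   [eps * eps - 1] vanishes, and makes the second equality a polynomial identity. *)
transitivity (u0 * v1 * (c0 * d1 + eps * (c1 * d0))
  + eps * (u1 * v0 * (c0 * d1 + eps * (c1 * d0)))
  + u0 * v0 * ((1 + eps) * (c1 * d1)) + u1 * v1 * ((1 + eps) * (c0 * d0))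
  + (eps * eps - 1) * (u1 * v1 * (1 + eps) * (c0 * d0) + u0 * v1 * (c0 * d1))).
  by rewrite c1d1 c0d0 eps2 cd; ring.
by ring.
Qed.

(** * Exchanging the two chains on a subset *)

Definition twist_a Y a b := [ffun x => if x \in Y then b x else a x].
(** The factor [eps] keeps the pairing equal to 1, as [<b, eps a> = eps <b, a> = <a, b>]. *)
Definition twist_b Y a b := [ffun x => if x \in Y then eps *: a x else b x].

Lemma twist_supplementary Y a b : supplementary formK a b ->
  supplementary formK (twist_a Y a b) (twist_b Y a b).
Proof.
move=> sab x; have [aa bb ab] := sab x; rewrite !ffunE.
case: (x \in Y); split=> //; rewrite ?formZl ?formZr ?aa ?mulr0 //.
by rewrite -formC.
Qed.

(** On [Y] the conditions against [a] and [b] trade places, and the nonzero factor [eps] does not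
    affect vanishing. *)
Lemma twist_feasible N Y a b X :
  chain_group_feasible formK N (twist_a Y a b) (twist_b Y a b) X <->
  chain_group_feasible formK N a b (symdiff X Y).
Proof.
split=> nex [f [fN f0 fa fb]]; apply: nex; exists f.
  split=> // x xX; rewrite ffunE; case: ifPn => xY; rewrite ?formZr.
  - by apply: fb; rewrite in_symdiff xY (negPf xX).
  - by apply: fa; rewrite in_symdiff (negPf xY) (negPf xX).
  - by rewrite fa ?mulr0 // in_symdiff xY xX.
  - by apply: fb; rewrite in_symdiff xX (negPf xY).
split=> // x; rewrite in_symdiff => xXY.
  case: (boolP (x \in X)) xXY => xX /=; last first.
    by move=> /negPf xY; have := fa x xX; rewrite ffunE xY.
  rewrite negbK => xY; have := fb x xX; rewrite ffunE xY formZr => /eqP.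
  by rewrite mulf_eq0 (negPf eps_neq0) => /eqP.
case: (boolP (x \in X)) xXY => xX /=.
  by move=> /negPf xY; have := fb x xX; rewrite ffunE xY.
by move=> xY; have := fa x xX; rewrite ffunE xY.
Qed.

(** * Lagrangian chain-groups as graphs of matrices *)

(** The hypotheses present [N] as the graph of [A], so an obstruction [f] to [X] corresponds to the
    kernel vector of its [a]-coordinates. Both directions of the theorem rely on this. *)
Lemma graph_feasible A N a b :
  (forall f, f \in N -> (forall x, formK (f x) (a x) = 0) -> f = 0) ->
  (forall u : V -> F, exists2 f, f \in N & forall x, formK (f x) (a x) = u x) ->
  (forall f, f \in N -> forall x,
     formK (f x) (b x) = \sum_y A x y * formK (f y) (a y)) ->
  forall X, chain_group_feasible formK N a b X <-> X \in nonsingular_sets A.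
Proof.
move=> injN surjN graphN X; split=> [feasX | /nonsingular_setsP nsX].
  apply/nonsingular_setsP=> u uX Au0 x; have [f fN fu] := surjN u.
  case: (eqVneq f 0) => [f0 | f_neq0].
    by rewrite -fu f0 ffunE form0l.
  case: feasX; exists f; split=> // y yX; first by rewrite fu uX.
  by rewrite graphN // -[RHS](Au0 _ yX); apply: eq_bigr => z _; rewrite fu.
case=> f [fN /eqP f0 fa fb]; apply: f0; apply: injN => //.
by apply: nsX => // x xX; rewrite -graphN // fb.
Qed.

Lemma lagrangian_matrix N a b :
  lagrangian formK N -> supplementary formK a b ->
  chain_group_feasible formK N a b set0 ->
  exists2 A : V -> V -> F, forall x y, A x y = - eps * A y x &
    forall X, chain_group_feasible formK N a b X <-> X \in nonsingular_sets A.
Proof.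
move=> [isoN dimN] sab feas0.
have injN f : f \in N -> (forall x, formK (f x) (a x) = 0) -> f = 0.
  move=> fN fa; apply/eqP/negP=> /negP f0; apply: feas0; exists f.
  by split=> // x; rewrite inE.
pose pfun f : {ffun V -> F^o} := [ffun x => formK (f x) (a x)].
have plin : linear pfun.
  by move=> c f g; apply/ffunP=> x; rewrite !ffunE formDl formZl.
pose p : {linear {ffun V -> 'cV[F]_2} -> {ffun V -> F^o}} :=
  HB.pack pfun (GRing.isLinear.Build _ _ _ _ pfun plin).
(* [p] is injective on [N], and [N] has the dimension of the target. *)
have imN : (linfun p @: N)%VS = fullv.
  apply/eqP; rewrite eqEdim subvf limg_dim_eq.
    by rewrite dimvf dimN leq_eqVlt /dim /= muln1 eqxx.
  apply/eqP; rewrite -subv0; apply/subvP=> f.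
  rewrite memv_cap memv_ker lfunE memv0 => /andP[fN /eqP/ffunP pf0].
  by apply/eqP/injN => // x; have := pf0 x; rewrite !ffunE.
have surjN (u : V -> F) :
    exists2 f, f \in N & forall x, formK (f x) (a x) = u x.
  have: ([ffun x => u x] : {ffun V -> F^o}) \in (linfun p @: N)%VS.
    by rewrite imN memvf.
  case/memv_imgP=> f fN; rewrite lfunE => /ffunP uf; exists f => // x.
  by have := uf x; rewrite !ffunE.
have /fin_all_exists[e eP] : forall y, exists f,
    f \in N /\ forall x, formK (f x) (a x) = (x == y)%:R.
  by move=> y; have [f fN fE] := surjN (fun x => (x == y)%:R); exists f.
(* Column [y] of the matrix holds the [b]-coordinates of [e y], the chain of [N] whose
   [a]-coordinates form the unit vector at [y]. Then [<e x, e y> = 0] reads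
   [A x y + eps * A y x = 0]. *)
exists (fun x y => formK (e y x) (b x)).
  move=> x y; have [[exN exE] [eyN eyE]] := (eP x, eP y).
  have := isoN _ _ exN eyN; rewrite /chain_form.
  under eq_bigr => z _ do rewrite (form_coord z _ _ sab) exE eyE.
  rewrite big_split /= -mulr_sumr (bigD1 x) //= big1 ?addr0; last first.
    by move=> z /negPf->; rewrite mul0r.
  rewrite (bigD1 y) //= big1 ?addr0; last first.
    by move=> z /negPf->; rewrite mulr0.
  by rewrite !eqxx mul1r mulr1 => /eqP; rewrite addr_eq0 mulNr => /eqP.
apply: graph_feasible => // f fN x.
(* Both sides lie in [N] and have the same [a]-coordinates. *)
have fE : f = \sum_y formK (f y) (a y) *: e y.
  apply/eqP; rewrite -subr_eq0; apply/eqP/injN.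
    by rewrite memvB // memv_suml // => y _; rewrite memvZ //; case: (eP y).
  move=> z; rewrite !ffunE formDl -scaleN1r formZl mulN1r.
  rewrite sum_ffunE form_suml (bigD1 z) //= big1 => [|y].
    by rewrite ffunE formZl (eP z).2 eqxx mulr1 addr0 subrr.
  by rewrite eq_sym ffunE formZl (eP y).2 => /negPf->; rewrite mulr0.
rewrite {1}fE sum_ffunE form_suml; apply: eq_bigr => y _.
by rewrite ffunE formZl mulrC.
Qed.

Lemma matrix_lagrangian A : (forall x y, A x y = - eps * A y x) ->
  exists2 N, lagrangian formK N & forall X,
    chain_group_feasible formK N [ffun=> pairK 1 0] [ffun=> pairK 0 1] X <->
    X \in nonsingular_sets A.
Proof.
move=> Asym.
(* Pairing [(s, t)] with [(1, 0)] gives [eps * t], and with [(0, 1)] gives [s]. Hence the second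
   entry [eps * u x] yields [a]-coordinate [u x], and the first yields [b]-coordinate [A u]. *)
pose gfun (u : {ffun V -> F^o}) : {ffun V -> 'cV[F]_2} :=
  [ffun x => pairK (\sum_y A x y * u y) (eps * u x)].
have glin : linear gfun.
  move=> c u v; apply/ffunP=> x; rewrite !ffunE; apply/colP=> i; rewrite !mxE.
  case: ifP => _; last by rewrite mulrDr mulrCA.
  rewrite mulr_sumr -big_split; apply: eq_bigr => y _ /=.
  by rewrite !ffunE mulrDr mulrCA.
pose g : {linear {ffun V -> F^o} -> {ffun V -> 'cV[F]_2}} :=
  HB.pack gfun (GRing.isLinear.Build _ _ _ _ gfun glin).
have gN u : g u = gfun u by [].
have inN f : f \in limg (linfun g) -> exists u, f = gfun u.
  by case/memv_imgP=> u _ ->; exists u; rewrite lfunE.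
have ga u x : formK (gfun u x) (pairK 1 0) = u x.
  by rewrite formE ffunE !mxE /= mulr0 mulr1 add0r mulrA eps2 mul1r.
have gb u x : formK (gfun u x) (pairK 0 1) = \sum_y A x y * u y.
  by rewrite formE ffunE !mxE /= !mulr0 mulr1 addr0.
exists (limg (linfun g)).
  split=> [f h /inN[u ->] /inN[v ->] | ].
    rewrite /chain_form.
    have -> : \sum_x formK (gfun u x) (gfun v x) =
      \sum_x (\sum_y eps * (v x * A x y * u y) + \sum_y u x * A x y * v y).
      apply: eq_bigr => x _; rewrite formE !ffunE !mxE /=; congr (_ + _).
        rewrite mulr_suml; apply: eq_bigr => y _; ring.
      rewrite mulrCA !mulrA -[eps * u x * eps]mulrAC eps2 mul1r mulr_sumr.
      by apply: eq_bigr => y _; rewrite mulrA.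
    (* Swapping the summation order in the first double sum pairs each [A y x] with [A x y], and the
       two terms cancel by the symmetry of [A]. *)
    rewrite big_split /= exchange_big -big_split big1 // => x _.
    rewrite -big_split big1 // => y _; rewrite (Asym y x) /=.
    transitivity (u x * A x y * v y * (1 - eps * eps)); first by ring.
    by rewrite eps2 subrr mulr0.
  rewrite limg_dim_eq ?dimvf ?[LHS]muln1 //.
  apply/eqP; rewrite -subv0; apply/subvP=> u.
  rewrite memv_cap memv_ker lfunE memv0 => /andP[_ /eqP gu0].
  by apply/eqP/ffunP=> x; rewrite -[LHS]ga -gN gu0 ffunE form0l ffunE.
apply: graph_feasible => [f /inN[u ->] fa | u | f /inN[u ->] x].
- have -> : u = 0; last by rewrite -gN linear0.
  by apply/ffunP=> x; have := fa x; rewrite ffunE ga => ->; rewrite ffunE.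
- exists (gfun [ffun x => u x]); last by move=> x; rewrite ffunE ga ffunE.
  by rewrite -gN -lfunE memv_img ?memvf.
by rewrite ffunE gb; apply: eq_bigr => y _; rewrite ffunE ga.
Qed.

(** * From matrices to delta-matroids by translation *)

(** The constant chains [(1, 0)] and [(0, 1)], twisted on [Y], serve as [a] and [b]; with [eps] a
    sign, the twisted value [eps *: a x] stays special. *)
Lemma special_representation_of_matrix (M : delta_matroid V) Y A :
  (eps == 1) || (eps == -1) -> (forall x y, A x y = - eps * A y x) ->
  feasible M = [set symdiff X Y | X in nonsingular_sets A] ->
  exists N a b, lagrangian formK N /\ special_representation formK M N a b.
Proof.
move=> eps1 Asym feasM; have [N lagN feasN] := matrix_lagrangian Asym.
pose a : {ffun V -> 'cV[F]_2} := [ffun=> pairK 1 0].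
pose b : {ffun V -> 'cV[F]_2} := [ffun=> pairK 0 1].
have sab : supplementary formK a b.
  by move=> x; rewrite !formE !ffunE !mxE /=; split; ring.
exists N, (twist_a Y a b), (twist_b Y a b); split=> //; split; first split.
- by case: lagN.
- exact: twist_supplementary.
- move=> X; rewrite feasM in_imset_symdiff; split=> [/feasN|] fX.
    exact/twist_feasible.
  by apply/feasN/twist_feasible.
- by move=> x; rewrite !ffunE; case: ifP; rewrite !inE eqxx ?orbT.
- move=> x; rewrite !ffunE; case: ifP => _; last by rewrite !inE eqxx ?orbT.
  by case/orP: eps1 => /eqP->; rewrite ?scale1r ?scaleN1r !inE eqxx ?orbT.
Qed.

Lemma matrix_of_representation (M : delta_matroid V) N a b :
  lagrangian formK N -> chain_group_representation formK M N a b ->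
  exists Y A, (forall x y, A x y = - eps * A y x) /\
    feasible M = [set symdiff X Y | X in nonsingular_sets A].
Proof.
(* Any feasible [Y] will do: after twisting on it, the empty set is feasible. *)
move=> lagN [_ sab feasN]; have /set0Pn[Y YM] := feasible_neq0 M.
have [|A Asym feasA] :=
    lagrangian_matrix (a := twist_a Y a b) (b := twist_b Y a b)
      lagN (twist_supplementary Y sab).
  by apply/twist_feasible/feasN; rewrite -(symdiffv Y) symdiffK.
exists Y, A; split=> //; apply/setP=> X; rewrite in_imset_symdiff.
apply/idP/idP=> [/feasN XN | /feasA/twist_feasible].
  by apply/feasA/twist_feasible; rewrite symdiffK.
by rewrite symdiffK => /feasN.
Qed.

End EpsilonForm.

(** * The two signs: [bplus] and [bminus] *)

Lemma bplusE (F : fieldType) (u v : 'cV[F]_2) :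
  bplus u v = u 0 0 * v 1 0 + 1 * (u 1 0 * v 0 0).
Proof. by rewrite mul1r. Qed.

Lemma bminusE (F : fieldType) (u v : 'cV[F]_2) :
  bminus u v = u 0 0 * v 1 0 + -1 * (u 1 0 * v 0 0).
Proof. by rewrite mulN1r. Qed.

Theorem theorem4p12 (F : fieldType) (V : finType) (M : delta_matroid V) :
  representable F M <->
  exists (formK : 'cV[F]_2 -> 'cV[F]_2 -> F)
         (N : {vspace {ffun V -> 'cV[F]_2}})
         (a b : {ffun V -> 'cV[F]_2}),
    [/\ formK = @bplus F \/ formK = @bminus F,
        lagrangian formK N &
        special_representation formK M N a b].
Proof.
have one2 : 1 * 1 = 1 :> F by rewrite mulr1.
have mone2 : -1 * -1 = 1 :> F by rewrite mulrNN mulr1.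
split=> [[Y [A [symA feasM]]] | [formK [N [a [b [formKE lagN [repN _ _]]]]]]].
  (* The relation [A x y = - eps * A y x] matches skew matrices with [bplus] and symmetric ones with
     [bminus]. *)
  case: symA => [[skewA _] | symA].
    have [||N [a [b []]]] := special_representation_of_matrix one2 (@bplusE F)
      _ _ feasM; rewrite ?eqxx //; first by move=> x y; rewrite mulN1r.
    by exists (@bplus F), N, a, b; split=> //; left.
  have [||N [a [b []]]] := special_representation_of_matrix mone2 (@bminusE F)
    _ _ feasM; rewrite ?eqxx ?orbT //.
    by move=> x y; rewrite opprK mul1r.
  by exists (@bminus F), N, a, b; split=> //; right.
case: formKE => formKE; rewrite {formK}formKE in lagN repN.
  have [Y [A [skewA feasM]]] :=
    matrix_of_representation one2 (@bplusE F) lagN repN.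
  exists Y, A; split=> //.
  (* In characteristic 2 the diagonal of a skew matrix is unconstrained. *)
  have [two0 | two_neq0] := eqVneq (2%:R : F) 0.
    right=> x y; rewrite skewA mulN1r; apply/eqP.
    by rewrite eq_sym -addr_eq0 -mulr2n -mulr_natl two0 mul0r.
  left; split=> [x y | x]; first by rewrite skewA mulN1r.
  apply/eqP; have /eqP := skewA x x; rewrite mulN1r -addr_eq0 -mulr2n.
  by rewrite -mulr_natl mulf_eq0 (negPf two_neq0).
have [Y [A [symA feasM]]] :=
  matrix_of_representation mone2 (@bminusE F) lagN repN.
by exists Y, A; split=> //; right=> x y; rewrite symA opprK mul1r.
Qed.
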